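(* Let $\Bbbk$ be a field of characteristic zero, let $U(3)$ be the associative conformal algebra defined below, and for $\alpha,\Delta\in\Bbbk$ let $M_{(\alpha,\Delta)}$ be the conformal $U(3)$-module defined below. If $\Delta\neq 0$, then \[ \dim_\Bbbk H^1(U(3),M_{(\alpha,\Delta)})=\begin{cases}2, & \Delta=1 \text{ and } \alpha=0,\\ 0, & \text{otherwise.}\end{cases} \]
   Context: A conformal algebra over $\Bbbk$ is a $\Bbbk[\partial]$-module $C$ with a bilinear $\lambda$-product $(a\,{}_{\lambda}\,b)=\sum_{n\ge0}\frac{\lambda^n}{n!}(a\,{}_{(n)}\,b)\in C[\lambda]$ (finitely many nonzero $n$-products) satisfying $(\partial a\,{}_\lambda\, b)=-\lambda(a\,{}_\lambda\, b)$ and $(a\,{}_\lambda\,\partial b)=(\partial+\lambda)(a\,{}_\lambda\, b)$; it is associative if $a\,{}_\lambda(b\,{}_\mu c)=(a\,{}_\lambda b)\,{}_{\lambda+\mu} c$. $U(3)$ is the associative conformal algebra generated by one element $v$ subject to the relations $v\,{}_{(n)}\,v=0$ for all $n\ge 3$ and $2\,v\,{}_{(1)}\,v-\partial(v\,{}_{(2)}\,v)=2v$ (equivalently, the universal associative conformal envelope of the Virasoro Lie conformal algebra $[v\,{}_\lambda\, v]=(\partial+2\lambda)v$ in which $v\,{}_{(n)}\,v=0$ for $n\ge3$). A left conformal module over an associative conformal algebra $C$ is a $\Bbbk[\partial]$-module $M$ with a bilinear map $C\otimes M\to M[\lambda]$, $a\otimes m\mapsto a\,{}_\lambda\, m$,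 satisfying $(\partial a)\,{}_\lambda m=-\lambda(a\,{}_\lambda m)$, $a\,{}_\lambda\,\partial m=(\partial+\lambda)(a\,{}_\lambda m)$, $a\,{}_\lambda(b\,{}_\mu m)=(a\,{}_\lambda b)\,{}_{\lambda+\mu}m$. For $\alpha,\Delta\in\Bbbk$, $M_{(\alpha,\Delta)}=\Bbbk[\partial]u$ is the free rank-one $\Bbbk[\partial]$-module with $v\,{}_\lambda\, u=(\alpha+\partial+\Delta\lambda)u$; this is a conformal $U(3)$-module for all $\alpha,\Delta$. Hochschild cohomology: the basic complex $\tilde C^n(C,M)$ ($n\ge1$) consists of maps $\varphi_{\bar\lambda}:C^{\otimes n}\to M[\lambda_1,\dots,\lambda_n]$ with $\varphi_{\bar\lambda}(a_1,\dots,\partial a_i,\dots,a_n)=-\lambda_i\varphi_{\bar\lambda}(a_1,\dots,a_n)$, and $\tilde C^0=M$; the differential is $(d\varphi)_{\bar\lambda}(a_1,\dots,a_{n+1})=a_1\,{}_{\lambda_1}\varphi_{(\lambda_2,\dots,\lambda_{n+1})}(a_2,\dots,a_{n+1})+\sum_{i=1}^n(-1)^i\varphi_{(\lambda_1,\dots,\lambda_i+\lambda_{i+1},\dots,\lambda_{n+1})}(a_1,\dots,a_i\,{}_{\lambda_i}a_{i+1},\dots,a_{n+1})$ (for $n=0$: $(dm)_\lambda(a)=a\,{}_\lambda m$). Each $\tilde C^n$ is a $\Bbbk[\partial]$-module via $(\partial\varphi)_{\bar\lambda}=(\partial+\sum_i\lambda_i)\varphi_{\bar\lambda}$, commuting with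 $d$; $H^n(C,M)$ denotes the cohomology of the reduced Hochschild complex $C^\bullet(C,M)=\tilde C^\bullet(C,M)/\partial\tilde C^\bullet(C,M)$. *)

(* Defs.v *)
(* Conformal algebras / modules / Hochschild cochains are encoded
   through their coefficients in the divided-power basis lambda^n/n!
   (i.e. via n-products a_(n) b), which is exactly what the lambda-product
   unfolds to: (a _lambda b) = sum_n lambda^n/n! (a_(n) b).  *)
From HB Require Import structures.
From mathcomp Require Import all_boot all_order all_algebra.
Set Implicit Arguments. Unset Strict Implicit. Unset Printing Implicit Defensive.
Import Order.TTheory GRing.Theory Num.Theory.
Local Open Scope ring_scope.

Section Defs.
Variable k : fieldType.

Definition klin (A B : lmodType k) (f : A -> B) : Prop :=
  forall (c : k) x y, f (c *: x + y) = c *: f x + f y.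

(* (V, D, pr): V a k-vector space, D = the action of partial (so V is a
   k[partial]-module), pr n a b = a_(n) b.  Associative conformal algebra axioms. *)
Definition is_assoc_conf_alg (V : lmodType k) (D : V -> V)
    (pr : nat -> V -> V -> V) : Prop :=
  [/\ klin D,
      (forall n b, klin (fun a => pr n a b)) /\ (forall n a, klin (pr n a)),
      (* finitely many nonzero n-products: (a _lambda b) \in V[lambda] *)
      (forall a b, exists N, forall n, (N <= n)%N -> pr n a b = 0),
      (* (partial a) _lambda b = - lambda (a _lambda b);
         a _lambda (partial b) = (partial + lambda)(a _lambda b) *)
      (forall n a b, pr n (D a) b = - (pr n.-1 a b *+ n)) /\
      (forall n a b, pr n a (D b) = D (pr n a b) + pr n.-1 a b *+ n) &
      (* a _lambda (b _mu c) = (a _lambda b) _(lambda+mu) c *)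
      (forall n m a b c, pr n a (pr m b c) =
         \sum_(s < n.+1) pr (n - s + m)%N (pr s a b) c *+ 'C(n, s))].

Definition u3_rel (V : lmodType k) (D : V -> V) (pr : nat -> V -> V -> V)
    (v : V) : Prop :=
  (forall n, (3 <= n)%N -> pr n v v = 0) /\
  pr 1%N v v *+ 2 - D (pr 2%N v v) = v *+ 2.

Definition conf_hom (V W : lmodType k) (D : V -> V) (pr : nat -> V -> V -> V)
    (DW : W -> W) (prW : nat -> W -> W -> W) (f : V -> W) : Prop :=
  [/\ klin f, (forall x, f (D x) = DW (f x)) &
      (forall n x y, f (pr n x y) = prW n (f x) (f y))].

Definition conf_generated (V : lmodType k) (D : V -> V)
    (pr : nat -> V -> V -> V) (v : V) : Prop :=
  forall P : V -> Prop,
    P v -> P 0 -> (forall (c : k) x y, P x -> P y -> P (c *: x + y)) ->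
    (forall x, P x -> P (D x)) ->
    (forall n x y, P x -> P y -> P (pr n x y)) ->
    forall x, P x.

Definition is_U3 (V : lmodType k) (D : V -> V) (pr : nat -> V -> V -> V)
    (v : V) : Prop :=
  [/\ is_assoc_conf_alg D pr, u3_rel D pr v, conf_generated D pr v &
      forall (W : lmodType k) (DW : W -> W) (prW : nat -> W -> W -> W) (w : W),
        is_assoc_conf_alg DW prW -> u3_rel DW prW w ->
        exists f : V -> W, conf_hom D pr DW prW f /\ f v = w].

(* The module M = k[partial] u is modelled by {poly k}, with partial acting as
   multiplication by 'X and u = 1.  act n a m = a_(n) m. *)
Definition is_conf_module_poly (V : lmodType k) (D : V -> V)
    (pr : nat -> V -> V -> V) (act : nat -> V -> {poly k} -> {poly k}) : Prop :=
  [/\ (forall n m, klin (fun a => act n a m)) /\ (forall n a, klin (act n a)),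
      (forall a m, exists N, forall n, (N <= n)%N -> act n a m = 0),
      (forall n a m, act n (D a) m = - (act n.-1 a m *+ n)),
      (forall n a m, act n a ('X * m) = 'X * act n a m + act n.-1 a m *+ n) &
      (forall n p a b m, act n a (act p b m) =
         \sum_(s < n.+1) act (n - s + p)%N (pr s a b) m *+ 'C(n, s))].

(* M_(alpha,Delta): v _lambda u = (alpha + partial + Delta lambda) u *)
Definition is_M_alpha_Delta (V : lmodType k) (D : V -> V)
    (pr : nat -> V -> V -> V) (v : V) (act : nat -> V -> {poly k} -> {poly k})
    (alpha Delta : k) : Prop :=
  [/\ is_conf_module_poly D pr act,
      act 0%N v 1 = alpha%:P + 'X, act 1%N v 1 = Delta%:P &
      forall n, (2 <= n)%N -> act n v 1 = 0].

(* Basic Hochschild cochains, in divided-power coefficients: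
   phi_lambda(a) = sum_j lambda^j/j! (phi j a),
   psi_(l1,l2)(a,b) = sum_{p,q} l1^p/p! l2^q/q! (psi p q a b). *)
Definition is_C1 (V : lmodType k) (D : V -> V) (phi : nat -> V -> {poly k}) : Prop :=
  [/\ forall j, klin (phi j),
      (forall a, exists N, forall j, (N <= j)%N -> phi j a = 0) &
      (forall j a, phi j (D a) = - (phi j.-1 a *+ j))].

Definition is_C2 (V : lmodType k) (D : V -> V)
    (psi : nat -> nat -> V -> V -> {poly k}) : Prop :=
  [/\ (forall p q b, klin (fun a => psi p q a b)) /\ (forall p q a, klin (psi p q a)),
      (forall a b, exists N, forall p q, (N <= p)%N || (N <= q)%N -> psi p q a b = 0),
      (forall p q a b, psi p q (D a) b = - (psi p.-1 q a b *+ p)) &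
      (forall p q a b, psi p q a (D b) = - (psi p q.-1 a b *+ q))].

(* partial acting on cochains: (partial phi)_lambda = (partial + sum lambda_i) phi *)
Definition delC1 (V : lmodType k) (phi : nat -> V -> {poly k}) : nat -> V -> {poly k} :=
  fun j a => 'X * phi j a + phi j.-1 a *+ j.

Definition delC2 (V : lmodType k) (psi : nat -> nat -> V -> V -> {poly k}) :
    nat -> nat -> V -> V -> {poly k} :=
  fun p q a b => 'X * psi p q a b + psi p.-1 q a b *+ p + psi p q.-1 a b *+ q.

(* Hochschild differentials: (dm)_lambda(a) = a _lambda m;
   (d phi)_(l1,l2)(a,b) = a _l1 phi_l2(b) - phi_(l1+l2)(a _l1 b) *)
Definition d0 (V : lmodType k) (act : nat -> V -> {poly k} -> {poly k})
    (m : {poly k}) : nat -> V -> {poly k} :=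
  fun j a => act j a m.

Definition d1 (V : lmodType k) (pr : nat -> V -> V -> V)
    (act : nat -> V -> {poly k} -> {poly k}) (phi : nat -> V -> {poly k}) :
    nat -> nat -> V -> V -> {poly k} :=
  fun p q a b => act p a (phi q b)
                 - \sum_(s < p.+1) phi (p - s + q)%N (pr s a b) *+ 'C(p, s).

(* 1-cocycles of the reduced complex C = C~ / partial C~ (represented by
   elements of C~^1 whose differential lies in partial C~^2) *)
Definition red_cocycle1 (V : lmodType k) (D : V -> V) (pr : nat -> V -> V -> V)
    (act : nat -> V -> {poly k} -> {poly k}) (phi : nat -> V -> {poly k}) : Prop :=
  is_C1 D phi /\
  exists psi, is_C2 D psi /\ forall p q a b, d1 pr act phi p q a b = delC2 psi p q a b.

Definition red_coboundary1 (V : lmodType k) (D : V -> V)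
    (act : nat -> V -> {poly k} -> {poly k}) (phi : nat -> V -> {poly k}) : Prop :=
  exists (m : {poly k}) (chi : nat -> V -> {poly k}),
    is_C1 D chi /\ forall j a, phi j a = d0 act m j a + delC1 chi j a.

Definition H1_dim (V : lmodType k) (D : V -> V) (pr : nat -> V -> V -> V)
    (act : nat -> V -> {poly k} -> {poly k}) (n : nat) : Prop :=
  exists phis : 'I_n -> nat -> V -> {poly k},
    [/\ forall i, red_cocycle1 D pr act (phis i),
        (forall c : 'I_n -> k,
            red_coboundary1 D act (fun j a => \sum_i c i *: phis i j a) ->
            forall i, c i = 0) &
        (forall psi, red_cocycle1 D pr act psi ->
           exists c : 'I_n -> k,
             red_coboundary1 D act (fun j a => psi j a - \sum_i c i *: phis i j a))].

End Defs.

(* Main.v *)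
(** Setting [lambda = -partial] identifies reduced 1-cochains with
    [k[partial]]-linear maps [F : U(3) -> M].  Since the right action on [M] is
    zero, [F] is a cocycle iff it is a homomorphism of left conformal modules, so
    it is determined by [p = F v].  Applying [F] to the defining relations gives
    [v_(n) p = 0] for [n >= 3], which forces [p = a + b partial] because
    [Delta <> 0], and [b alpha + (Delta - 1) a = 0].  Conversely such a [p] extends
    to a homomorphism by the universal property of [U(3)] applied to the split
    null extension of [U(3)] by [M].  Finally [d u] has
    [p = alpha + (1 - Delta) partial], and [M / partial M] is one-dimensional, so
    [H^1] is the line [b alpha + (Delta - 1) a = 0] modulo itself, unless
    [alpha = 0] and [Delta = 1], when all [(a, b)] occur and [d u = 0]. *)
Require Import Defs.
From Stdlib Require Import ClassicalEpsilon.
From HB Require Import structures.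
From mathcomp Require Import all_boot all_order all_algebra.
From mathcomp Require Import ring zify.
Import GRing.Theory.
Local Open Scope ring_scope.
Set Implicit Arguments. Unset Strict Implicit. Unset Printing Implicit Defensive.

Lemma functional_choice (A B : Type) (R : A -> B -> Prop) :
  (forall a, exists b, R a b) -> exists f, forall a, R a (f a).
Proof.
move=> h; exists (fun a => proj1_sig (constructive_indefinite_description _ (h a))) => a.
by case: (constructive_indefinite_description _ _).
Qed.

(** Transports a known equation to the goal, leaving an identity of differences that [ring] can
    check. *)
Lemma eq_of_subr_eq (A : zmodType) (a b c d : A) : a = b -> c - d = a - b -> c = d.
Proof. by move=> ->; rewrite subrr => /eqP; rewrite subr_eq0 => /eqP. Qed.

(** * Consequences of linearity *)

Section Klin.
Variables (k : fieldType) (A B : lmodType k) (f : A -> B).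
Hypothesis fL : klin f.

Lemma klinD x y : f (x + y) = f x + f y.
Proof. by rewrite -[x]scale1r fL !scale1r. Qed.

Lemma klin0 : f 0 = 0.
Proof. by apply: (addrI (f 0)); rewrite -klinD !addr0. Qed.

Lemma klinZ c x : f (c *: x) = c *: f x.
Proof. by rewrite -[c *: x]addr0 fL klin0 addr0. Qed.

Lemma klinN x : f (- x) = - f x.
Proof. by rewrite -scaleN1r klinZ scaleN1r. Qed.

Lemma klinMn x n : f (x *+ n) = f x *+ n.
Proof. by rewrite -scaler_nat klinZ scaler_nat. Qed.

Lemma klin_sum (I : Type) (r : seq I) (P : pred I) (g : I -> A) :
  f (\sum_(i <- r | P i) g i) = \sum_(i <- r | P i) f (g i).
Proof. by apply: (big_morph f); [exact: klinD|exact: klin0]. Qed.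

End Klin.

(** * Division by [partial + lambda] with remainder free of [lambda] *)

Section DividedPowers.
Variable k : fieldType.
Hypothesis hchar : [pchar k] =i pred0.

Definition fin_supp (u : nat -> {poly k}) := exists N, forall j, (N <= j)%N -> u j = 0.

Lemma fin_suppD c u w : fin_supp u -> fin_supp w -> fin_supp (fun j => c *: u j + w j).
Proof.
move=> [N hN] [M hM]; exists (maxn N M) => j; rewrite geq_max => /andP[h1 h2].
by rewrite hN // hM // scaler0 addr0.
Qed.

(* Multiplication by [partial + lambda] on divided-power coefficients. *)
Definition del (u : nat -> {poly k}) j := 'X * u j + u j.-1 *+ j.

(** Multiplication by [partial + lambda_1 + lambda_2]. *)
Definition del2 (u : nat -> nat -> {poly k}) p q :=
  'X * u p q + u p.-1 q *+ p + u p q.-1 *+ q.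

Lemma delL c u w j : del (fun j => c *: u j + w j) j = c *: del u j + del w j.
Proof. by rewrite /del -!mul_polyC; ring. Qed.

Lemma del2L c u w p q :
  del2 (fun p q => c *: u p q + w p q) p q = c *: del2 u p q + del2 w p q.
Proof. by rewrite /del2 -!mul_polyC; ring. Qed.

Lemma polyMn_eq0 (f : {poly k}) n : f *+ n.+1 = 0 -> f = 0.
Proof.
rewrite -scaler_nat => /eqP; rewrite scaler_eq0.
by rewrite ((pcharf0P k).1 hchar) => /eqP.
Qed.

(* The coefficient of [lambda^(N+1)] determines the top coefficient [u N]. *)
Lemma del_inj u : fin_supp u -> (forall j, del u j.+1 = 0) -> forall j, u j = 0.
Proof.
case=> N hN hu; have h n : forall j, (N - n <= j)%N -> u j = 0.
  elim: n => [|n IH] j; first by rewrite subn0; apply: hN.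
  move=> hj; case: (leqP (N - n) j) => [/IH //|hj'].
  have := hu j; rewrite /del /= (IH j.+1) ?mulr0 ?add0r; last by lia.
  exact: polyMn_eq0.
by move=> j; apply: (h N); rewrite subnn.
Qed.

(** Uniqueness of the remainder: [f] enters only at index 0, so [del_inj] first kills [u]. *)
Lemma del_direct f u : fin_supp u ->
  (forall j, f *+ (j == 0)%N + del u j = 0) -> f = 0 /\ forall j, u j = 0.
Proof.
move=> su hu; have u0 : forall j, u j = 0.
  by apply: del_inj => // j; have := hu j.+1; rewrite mulr0n add0r.
split=> //; have := hu 0%N.
by rewrite /del !u0 mulr0 mul0rn !addr0 mulr1n.
Qed.

(** Induction on [p]: once row [p - 1] vanishes, row [p] satisfies the one-variable equation of
    [del_inj]. Only positive second indices are constrained, because the homomorphism defect in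
    [d1_reduction] sits at [q = 0]. *)
Lemma del2_inj u : (forall p, fin_supp (u p)) ->
  (forall p q, del2 u p q.+1 = 0) -> forall p q, u p q = 0.
Proof.
move=> su hu; elim=> [|p IH]; apply: del_inj => // q.
  by have := hu 0%N q; rewrite /del2 mulr0n addr0.
by have := hu p.+1 q; rewrite /del2 IH mul0rn addr0.
Qed.

Lemma del_surj u : fin_supp u ->
  exists f w, fin_supp w /\ forall j, u j = f *+ (j == 0)%N + del w j.
Proof.
case=> N; elim: N u => [|[|N] IH] u hu.
- exists 0, (fun=> 0); split; first by exists 0%N.
  by move=> j; rewrite /del hu // mulr0 !mul0rn !addr0.
- exists (u 0%N), (fun=> 0); split; first by exists 0%N.
  by case=> [|j]; rewrite /del mulr0 !mul0rn !addr0 ?mulr1n // hu.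
(* Chosen so that [del e] has the same coefficient as [u] at the top index [N.+1]; subtracting it
   shortens the support. *)
pose w := (N.+1%:R^-1 : k) *: u N.+1.
pose e j := w *+ (j == N)%N.
have eN : u N.+1 = e N *+ N.+1.
  rewrite /e eqxx mulr1n -scaler_nat scalerA divff ?scale1r //.
  by rewrite ((pcharf0P k).1 hchar).
have se : fin_supp e by exists N.+1 => j hj; rewrite /e; case: eqP => // ?; lia.
have [j hj|f [x [sx hx]]] := IH (fun j => u j - del e j).
  rewrite /del; case: (eqVneq j N.+1) => [->|hj'].
    by rewrite -eN /e (gtn_eqF (ltnSn N)) mulr0n mulr0 add0r subrr.
  rewrite hu ?/e; last by lia.
  have -> : (j == N) = false by lia.
  have -> : (j.-1 == N) = false by lia.
  by rewrite !mulr0n mulr0 mul0rn addr0 subr0.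
exists f, (fun j => 1 *: e j + x j); split; first exact: fin_suppD.
by move=> j; rewrite delL scale1r addrCA -hx; ring.
Qed.

(** The left side lists the coefficients of [f(-lambda)], which agrees with [f(partial)] modulo
    [partial + lambda]. In the Horner step the quotient [w] becomes [-lambda w - f]. *)
Lemma sign_fact_coef (f : {poly k}) :
  exists w, fin_supp w /\
    forall j, ((-1) ^+ j * f`_j *+ j`!)%:P = f *+ (j == 0)%N + del w j.
Proof.
elim/poly_ind: f => [|f c [w [sw hw]]].
  exists (fun=> 0); split; first by exists 0%N.
  by move=> j; rewrite /del coef0 !mulr0 !mul0rn !addr0 polyC0.
exists (fun j => - (w j.-1 *+ j) - f *+ (j == 0)%N); split.
  case: sw => N hN; exists N.+1 => -[//|j] hj.
  by rewrite hN /= ?mul0rn ?mulr0n ?subr0 ?oppr0.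
case=> [|j].
  by rewrite /del coefD coefMX coefC /= expr0 mul1r add0r !mulr1n; ring.
have -> : ((-1) ^+ j.+1 * (f * 'X + c%:P)`_j.+1 *+ j.+1`!)%:P
          = - (((-1) ^+ j * f`_j *+ j`!)%:P *+ j.+1).
  rewrite coefD coefMX coefC /= addr0 factS exprS mulrnA mulrnAC -polyCMn -polyCN.
  by congr (_ %:P); ring.
rewrite hw /del; case: j => [|j] /=; ring.
Qed.

End DividedPowers.

(** * Reduced 1-cochains as [k[partial]]-linear maps *)

Section Cochains.
Variables (k : fieldType) (hchar : [pchar k] =i pred0).
Variables (V : lmodType k) (D : V -> V) (pr : nat -> V -> V -> V).
Variable (act : nat -> V -> {poly k} -> {poly k}).
Hypothesis (hA : is_assoc_conf_alg D pr) (hM : is_conf_module_poly D pr act).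

Implicit Types (phi e : nat -> V -> {poly k}) (F G : V -> {poly k}).

(** Division with remainder, [phi_lambda(a) = F(a) + (partial + lambda) e_lambda(a)], done
    separately for each [a]; linearity of [F] and [e] is recovered from uniqueness. *)
Definition is_reduction phi F e :=
  (forall a, fin_supp (e^~ a)) /\
  forall j a, phi j a = F a *+ (j == 0)%N + del (e^~ a) j.

Definition is_mod_hom F :=
  [/\ klin F, forall a, F (D a) = 'X * F a &
      forall n a b, F (pr n a b) = act n a (F b)].

Lemma reduction_exists phi : is_C1 D phi -> exists F e, is_reduction phi F e.
Proof.
case=> _ sphi _.
have [F hF] := functional_choice (fun a => del_surj hchar (sphi a)).
have [e he] := functional_choice hF.
by exists F, (fun j a => e a j); split=> [a|j a]; case: (he a).
Qed.

(** Uniqueness of division applied to the axioms of [phi]. The extra [- F a] comes from [-lambda F =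
    partial F - (partial + lambda) F], so [e] alone is in general not a cochain. *)
Lemma reduction_lin phi F e : is_C1 D phi -> is_reduction phi F e ->
  [/\ klin F, forall j, klin (e j), forall a, F (D a) = 'X * F a &
      forall j a, e j (D a) = - (e j.-1 a *+ j) - F a *+ (j == 0)%N].
Proof.
move=> [phiL _ phiD] [se he].
have L c x y : F (c *: x + y) - (c *: F x + F y) = 0 /\
    forall j, e j (c *: x + y) - (c *: e j x + e j y) = 0.
  apply: (@del_direct _ hchar _ (fun j => e j (c *: x + y) - (c *: e j x + e j y))).
    have := fin_suppD (-1) (fin_suppD c (se x) (se y)) (se (c *: x + y)).
    by case=> N hN; exists N => j /hN; rewrite scaleN1r addrC => ->.
  move=> j; have := phiL j c x y; rewrite !he /del -!mul_polyC => h.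
  apply: (eq_of_subr_eq h); ring.
have S a : F (D a) - 'X * F a = 0 /\
    forall j, e j (D a) + (e j.-1 a *+ j) + F a *+ (j == 0)%N = 0.
  apply: (@del_direct _ hchar _
    (fun j => e j (D a) + (e j.-1 a *+ j) + F a *+ (j == 0)%N)).
    case: (se a) (se (D a)) => N hN [M hM']; exists (maxn N M).+1 => -[//|j] hj.
    by rewrite hM' ?hN ?mul0rn ?mulr0n ?addr0 //=; lia.
  move=> j; have := phiD j a; rewrite !he /del.
  case: j => [|[|j]] /=; rewrite ?mulr0n ?mulr1n => h; apply: (eq_of_subr_eq h); ring.
split=> [c x y|j c x y|a|j a].
- by apply/eqP; rewrite -subr_eq0; apply/eqP; case: (L c x y).
- by apply/eqP; rewrite -subr_eq0; apply/eqP; case: (L c x y).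
- by apply/eqP; rewrite -subr_eq0; apply/eqP; case: (S a).
- case: (S a) => _ /(_ j) h; apply: (eq_of_subr_eq h); ring.
Qed.

(** The failure of sesquilinearity of [e] depends only on [F], so it cancels in [e - e'], which is
    therefore a cochain. *)
Lemma cohomologous phi F e phi' F' e' :
  is_C1 D phi -> is_reduction phi F e -> is_C1 D phi' -> is_reduction phi' F' e' ->
  F =1 F' -> exists chi, is_C1 D chi /\ forall j a, phi j a = phi' j a + delC1 chi j a.
Proof.
move=> C he C' he' eqF.
have [_ eL _ eD] := reduction_lin C he; have [_ eL' _ eD'] := reduction_lin C' he'.
exists (fun j a => e j a - e' j a); split; first split.
- by move=> j c x y; rewrite eL eL' -!mul_polyC; ring.
- move=> a; case: (he.1 a) (he'.1 a) => N hN [M hM']; exists (maxn N M) => j.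
  by rewrite geq_max => /andP[/hN -> /hM' ->]; rewrite subrr.
- by move=> j a; rewrite eD eD' eqF; ring.
by move=> j a; rewrite he.2 he'.2 eqF /delC1 /del; ring.
Qed.

(** Computes [F] at a single element from any decomposition there, with no cochain structure on
    [w]. *)
Lemma reduction_uniq phi F e a f w : is_reduction phi F e -> fin_supp w ->
  (forall j, phi j a = f *+ (j == 0)%N + del w j) -> F a = f.
Proof.
move=> [se he] sw hw; apply/eqP; rewrite -subr_eq0; apply/eqP.
apply: (proj1 (@del_direct _ hchar _ (fun j => -1 *: w j + e j a) _ _)).
  exact: fin_suppD.
by move=> j; have := he j a; rewrite hw delL scaleN1r => /esym h; apply: (eq_of_subr_eq h); ring.
Qed.

(** * The differential in terms of reductions *)

Lemma d1D phi phi' p q a b :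
  d1 pr act (fun j a => phi j a + phi' j a) p q a b
  = d1 pr act phi p q a b + d1 pr act phi' p q a b.
Proof.
case: hM => -[_ actL] _ _ _ _; rewrite /d1 (klinD (actL p a)).
under eq_bigr do rewrite mulrnDl.
by rewrite big_split /=; ring.
Qed.

Lemma d1_const F p q a b :
  d1 pr act (fun j a => F a *+ (j == 0)%N) p q a b
  = (act p a (F b) - F (pr p a b)) *+ (q == 0)%N.
Proof.
case: hM => -[_ actL] _ _ _ _; rewrite /d1 (klinMn (actL p a)) big_ord_recr /=.
rewrite subnn binn mulr1n big1 ?add0r; first by rewrite -mulrnBl.
move=> s _; have -> : (p - s + q == 0)%N = false by have := ltn_ord s; lia.
by rewrite mulr0n mul0rn.
Qed.

Lemma d1_del e p q a b : d1 pr act (delC1 e) p q a b = delC2 (d1 pr act e) p q a b.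
Proof.
case: hM => -[_ actL] _ _ actX _; rewrite /d1 /delC1 /delC2.
rewrite (klinD (actL p a)) actX (klinMn (actL p a)).
have -> : \sum_(s < p.+1) ('X * e (p - s + q)%N (pr s a b)
                   + e (p - s + q).-1 (pr s a b) *+ (p - s + q)) *+ 'C(p, s)
  = 'X * (\sum_(s < p.+1) e (p - s + q)%N (pr s a b) *+ 'C(p, s))
    + (\sum_(s < p.-1.+1) e (p.-1 - s + q)%N (pr s a b) *+ 'C(p.-1, s)) *+ p
    + (\sum_(s < p.+1) e (p - s + q.-1)%N (pr s a b) *+ 'C(p, s)) *+ q; last by ring.
have E (s : 'I_p.+1) : ('X * e (p - s + q)%N (pr s a b)
                   + e (p - s + q).-1 (pr s a b) *+ (p - s + q)) *+ 'C(p, s)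
  = 'X * (e (p - s + q)%N (pr s a b) *+ 'C(p, s))
    + e (p - s + q).-1 (pr s a b) *+ 'C(p.-1, s) *+ p
    + e (p - s + q.-1)%N (pr s a b) *+ 'C(p, s) *+ q.
  (* By [(p - s) C(p, s) = p C(p - 1, s)], the factor [lambda_1 + lambda_2] splits into the two
     index shifts of [delC2]. *)
  have B : ((p - s + q) * 'C(p, s) = 'C(p.-1, s) * p + 'C(p, s) * q)%N.
    by rewrite mulnDl -mul_bin_down mulnC [(q * _)%N]mulnC.
  have T : e (p - s + q).-1 (pr s a b) *+ q = e (p - s + q.-1)%N (pr s a b) *+ q.
    by case: (q) => [|q'] //; rewrite addnS.
  rewrite mulrnDl mulrnAr -!mulrnA B mulrnDr addrA; congr (_ + _).
  by rewrite mulrnA mulrnAC T mulrnAC -mulrnA.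
under eq_bigr do rewrite E.
rewrite !big_split /= -mulr_sumr !sumrMnl; congr (_ + _ + _).
case: p E => [|p] _ //=; congr (_ *+ _).
rewrite big_ord_recr /= bin_small // mulr0n addr0; apply: eq_bigr => s _.
by rewrite subSn // leq_ord.
Qed.

Lemma d1_reduction phi F e p q a b : is_reduction phi F e ->
  d1 pr act phi p q a b
  = (act p a (F b) - F (pr p a b)) *+ (q == 0)%N + delC2 (d1 pr act e) p q a b.
Proof.
case=> _ he; rewrite -d1_const -d1_del -d1D /d1 he; congr (_ - _).
by apply: eq_bigr => s _; rewrite he.
Qed.

Lemma d1_lin phi : (forall j, klin (phi j)) ->
  (forall p q b, klin (fun a => d1 pr act phi p q a b)) /\
  (forall p q a, klin (d1 pr act phi p q a)).
Proof.
case: hM hA => -[actLl actL] _ _ _ _ [_ [prLl prL] _ _ _] phiL.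
have D3 (x y z w : {poly k}) c : c *: x + y - (c *: z + w) = c *: (x - z) + (y - w).
  by rewrite -!mul_polyC; ring.
split=> [p q b c x y|p q a c x y]; rewrite /d1.
  rewrite actLl -D3 scaler_sumr -big_split; congr (_ - _); apply: eq_bigr => s _.
  by rewrite prLl phiL mulrnDl -scalerMnr.
rewrite phiL actL -D3 scaler_sumr -big_split; congr (_ - _); apply: eq_bigr => s _.
by rewrite prL phiL mulrnDl -scalerMnr.
Qed.

Lemma d1_fin_supp phi a b : (forall j, klin (phi j)) -> (forall x, fin_supp (phi^~ x)) ->
  exists N, forall p q, (N <= p)%N || (N <= q)%N -> d1 pr act phi p q a b = 0.
Proof.
case: hM hA => -[actLl actL] actN _ _ _ [_ _ prN _ _] phiL phiN.
(* Finitely many finitely supported sequences share one bound; this gives a bound joint in [p] and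
   [q]. *)
have unif (T : Type) (u : nat -> nat -> T) z :
    (forall s, exists N, forall j, (N <= j)%N -> u s j = z) ->
    forall n, exists N, forall s j, (s < n)%N -> (N <= j)%N -> u s j = z.
  move=> hu; elim=> [|n [N IH]]; first by exists 0%N.
  have [M hM'] := hu n; exists (maxn N M) => s j; rewrite ltnS geq_max.
  by case: ltngtP => // [/IH h _ /andP[/h]|-> _ /andP[_ /hM']].
have [N1 h1] := phiN b.
have [N2 h2] := unif _ (fun q p => act p a (phi q b)) 0 (fun q => actN a (phi q b)) N1.
have [N3 h3] := prN a b.
have [N4 h4] := unif _ (fun s j => phi j (pr s a b)) 0 (fun s => phiN (pr s a b)) N3.
exists (maxn (maxn N1 N2) (N3 + N4)) => p q hpq.
rewrite /d1 big1 => [|s _].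
  rewrite subr0; case: (leqP N1 q) => hq; first by rewrite h1 // (klin0 (actL p a)).
  by rewrite h2 //; lia.
case: (leqP N3 s) => hs; first by rewrite h3 // (klin0 (phiL _)) mul0rn.
by rewrite h4 ?mul0rn //; lia.
Qed.

Lemma d1_sesqui phi : is_C1 D phi ->
  (forall p q a b, d1 pr act phi p q (D a) b = - (d1 pr act phi p.-1 q a b *+ p)) /\
  (forall p q a b, d1 pr act phi p q a (D b) = - (d1 pr act phi p q.-1 a b *+ q)).
Proof.
case: hM hA => -[actLl actL] _ actD _ _ [_ _ _ [prDl prDr] _] [phiL _ phiD].
split=> p q a b; rewrite /d1.
  rewrite actD mulrnBl opprB [LHS]addrC; congr (_ + _).
  case: p => [|p].
    by rewrite mulr0n big_ord1 prDl mulr0n oppr0 (klin0 (phiL _)) mul0rn oppr0.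
  rewrite big_ord_recl /= prDl mulr0n oppr0 (klin0 (phiL _)) mul0rn add0r.
  rewrite -sumrN -sumrMnl; apply: eq_bigr => s _.
  rewrite /bump /= !add1n prDl (klinN (phiL _)) (klinMn (phiL _)) /= subSS mulNrn opprK.
  by rewrite -!mulrnA -mul_bin_diag mulnC.
rewrite phiD (klinN (actL _ _)) (klinMn (actL _ _)) mulrnBl opprB addrC; congr (_ - _).
have E (s : 'I_p.+1) : phi (p - s + q)%N (pr s a (D b)) *+ 'C(p, s)
  = phi (p - s + q)%N (pr s.-1 a b) *+ (s * 'C(p, s))
    - phi (p - s + q).-1 (pr s a b) *+ ((p - s) * 'C(p, s))
    - phi (p - s + q).-1 (pr s a b) *+ 'C(p, s) *+ q.
  rewrite prDr (klinD (phiL _)) (klinMn (phiL _)) phiD; ring.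
under eq_bigr do rewrite E.
rewrite !big_split /= !sumrN.
(* Shift [s] by one and use [(s + 1) C(p, s + 1) = (p - s) C(p, s)]; the two end terms carry a zero
   factor. *)
have -> : \sum_(s < p.+1) phi (p - s + q)%N (pr s.-1 a b) *+ (s * 'C(p, s))
        = \sum_(s < p.+1) phi (p - s + q).-1 (pr s a b) *+ ((p - s) * 'C(p, s)).
  rewrite big_ord_recl /= mul0n mulr0n add0r big_ord_recr /= subnn mul0n mulr0n addr0.
  apply: eq_bigr => s _; rewrite /bump /= add1n mul_bin_left /=.
  by congr (phi _ _ *+ _); have := ltn_ord s; lia.
rewrite subrr add0r opprK -sumrMnl; apply: eq_bigr => s _.
by case: q {E} => [|q]; rewrite ?mulr0n //= addnS.
Qed.

(* Uniqueness of [psi] in [d1 phi = delC2 psi] makes it inherit the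
   sesquilinearity of [d1 phi]. *)
Lemma cocycle_of_hom phi F e :
  is_C1 D phi -> is_reduction phi F e -> is_mod_hom F -> red_cocycle1 D pr act phi.
Proof.
move=> C he [_ _ Fhom]; split=> //; exists (d1 pr act e).
have [_ eL _ _] := reduction_lin C he.
have dE p q a b : d1 pr act phi p q a b = delC2 (d1 pr act e) p q a b.
  by rewrite (d1_reduction _ _ _ _ he) Fhom subrr mul0rn add0r.
have [Sl Sr] := d1_sesqui C.
have fs a b := d1_fin_supp a b eL he.1.
split; last exact: dE.
split; [exact: d1_lin|exact: fs| |] => p q a b.
- pose u p q := d1 pr act e p q (D a) b + d1 pr act e p.-1 q a b *+ p.
  suff: u p q = 0 by move/eqP; rewrite addr_eq0 => /eqP.
  apply: (@del2_inj _ hchar) => {p q} p.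
    case: (fs a b) (fs (D a) b) => N hN [M hM']; exists (maxn N M) => q hq.
    by rewrite /u hN ?hM' ?mul0rn ?addr0 //; lia.
  move=> q; have := Sl p q.+1 a b; rewrite !dE /delC2 /del2 /u => h.
  by case: p h => [|p] /= h; apply: (eq_of_subr_eq h); ring.
- pose u p q := d1 pr act e p q a (D b) + d1 pr act e p q.-1 a b *+ q.
  suff: u p q = 0 by move/eqP; rewrite addr_eq0 => /eqP.
  apply: (@del2_inj _ hchar) => {p q} p.
    case: (fs a b) (fs a (D b)) => N hN [M hM']; exists (maxn N M).+1 => -[//|q] hq.
    by rewrite /u hN ?hM' ?mul0rn ?addr0 //=; lia.
  move=> q; have := Sr p q.+1 a b; rewrite !dE /delC2 /del2 /u => h.
  by case: q h => [|q] /= h; apply: (eq_of_subr_eq h); ring.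
Qed.

(** The difference of [psi] and [d1 e] has its [del2] concentrated at [q = 0], hence vanishes by
    [del2_inj]; the entry at [q = 0] is then the homomorphism defect. *)
Lemma hom_of_cocycle phi F e :
  red_cocycle1 D pr act phi -> is_reduction phi F e -> is_mod_hom F.
Proof.
move=> [C [psi [[_ psiN _ _] hpsi]]] he.
have [FL eL FD _] := reduction_lin C he; split=> // n a b.
pose u p q := -1 *: d1 pr act e p q a b + psi p q a b.
have hu p q : del2 u p q = (act p a (F b) - F (pr p a b)) *+ (q == 0)%N.
  have := hpsi p q a b; rewrite (d1_reduction _ _ _ _ he) /delC2 /u => /esym h.
  by rewrite del2L scaleN1r /del2; apply: (eq_of_subr_eq h); ring.
have u0 : forall p q, u p q = 0.
  apply: (@del2_inj _ hchar) => [p|p q]; last by rewrite hu mulr0n.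
  apply: fin_suppD.
    have [N hN] := d1_fin_supp a b eL he.1.
    by exists N => q hq; apply: hN; rewrite hq orbT.
  by have [N hN] := psiN a b; exists N => q hq; apply: hN; rewrite hq orbT.
have := hu n 0%N; rewrite /del2 !u0 mulr0 !mul0rn !addr0 mulr1n => /esym/eqP.
by rewrite subr_eq0 => /eqP.
Qed.

(* In generating-function form the lift is [phi_lambda(a) = F(a)|_(partial := -lambda)]. *)
Lemma lift_of_hom F : klin F -> (forall a, F (D a) = 'X * F a) ->
  exists phi e, is_C1 D phi /\ is_reduction phi F e.
Proof.
move=> FL FD.
have [e he] := functional_choice (fun a => sign_fact_coef (F a)).
exists (fun j a => ((-1) ^+ j * (F a)`_j *+ j`!)%:P), (fun j a => e a j); split; last first.
  by split=> [a|j a]; case: (he a).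
split=> [j c x y|a|j a].
- rewrite FL coefD coefZ -mul_polyC -polyCM -polyCD; congr (_ %:P); ring.
- by exists (size (F a)) => j hj; rewrite nth_default // mulr0 mul0rn.
- rewrite FD coefXM; case: j => [|j] /=; first by rewrite mulr0 mul0rn mulr0n oppr0.
  rewrite factS exprS -polyCMn -polyCN; congr (_ %:P); ring.
Qed.

Lemma d0_cocycle m : red_cocycle1 D pr act (d0 act m).
Proof.
case: hM => -[actLl actL] actN actD _ actA; split.
  by split=> [j c x y|a|j a]; [exact: actLl|exact: actN|exact: actD].
exists (fun _ _ _ _ => 0); split.
  split; [split=> p q x c y z; by rewrite scaler0 addr0|by move=> *; exists 0%N| |];
    by move=> *; rewrite mul0rn oppr0.
by move=> p q a b; rewrite /d1 /d0 actA subrr /delC2 mulr0 !mul0rn !addr0.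
Qed.

(** * Linear combinations, and homomorphisms determined by the generator *)

Lemma mod_hom_sum (n : nat) (c : 'I_n -> k) (F : 'I_n -> V -> {poly k}) :
  (forall i, is_mod_hom (F i)) -> is_mod_hom (fun a => \sum_i c i *: F i a).
Proof.
case: hM => -[_ actL] _ _ _ _ hF; split=> [d x y|a|j a b].
- rewrite scaler_sumr -big_split; apply: eq_bigr => i _ /=; case: (hF i) => FL _ _.
  by rewrite FL scalerDr !scalerA [d * _]mulrC.
- rewrite mulr_sumr; apply: eq_bigr => i _; case: (hF i) => _ FD _.
  by rewrite FD scalerAr.
- rewrite (klin_sum (actL _ _)); apply: eq_bigr => i _; case: (hF i) => _ _ FH.
  by rewrite FH (klinZ (actL _ _)).
Qed.

Lemma C1_sum (n : nat) (c : 'I_n -> k) (phi : 'I_n -> nat -> V -> {poly k}) :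
  (forall i, is_C1 D (phi i)) -> is_C1 D (fun j a => \sum_i c i *: phi i j a).
Proof.
move=> hC; split=> [j d x y|a|j a].
- rewrite scaler_sumr -big_split; apply: eq_bigr => i _ /=; case: (hC i) => L _ _.
  by rewrite L scalerDr !scalerA [d * _]mulrC.
- have /functional_choice[N hN] : forall i, fin_supp (phi i ^~ a) by move=> i; case: (hC i) => _ /(_ a).
  exists (\max_i N i) => j /bigmax_leqP hj; apply: big1 => i _.
  by rewrite hN ?scaler0 // hj.
- rewrite -sumrMnl -sumrN; apply: eq_bigr => i _; case: (hC i) => _ _ ->.
  by rewrite scalerN scalerMnr.
Qed.

Lemma reduction_sum (n : nat) (c : 'I_n -> k) (phi e : 'I_n -> nat -> V -> {poly k})
    (F : 'I_n -> V -> {poly k}) :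
  (forall i, is_reduction (phi i) (F i) (e i)) ->
  is_reduction (fun j a => \sum_i c i *: phi i j a) (fun a => \sum_i c i *: F i a)
    (fun j a => \sum_i c i *: e i j a).
Proof.
move=> hr; split=> [a|j a].
  have /functional_choice[N hN] : forall i, fin_supp (e i ^~ a) by move=> i; case: (hr i) => /(_ a).
  exists (\max_i N i) => j /bigmax_leqP hj; apply: big1 => i _.
  by rewrite hN ?scaler0 // hj.
rewrite /del mulr_sumr -!sumrMnl -!big_split; apply: eq_bigr => i _ /=.
by rewrite (hr i).2 /del !scalerDr scalerAr !scalerMnr.
Qed.

Lemma mod_hom_eq v F G : conf_generated D pr v -> is_mod_hom F -> is_mod_hom G ->
  F v = G v -> F =1 G.
Proof.
move=> gen [FL FD FH] [GL GD GH] ev; apply: gen => //.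
- by rewrite (klin0 FL) (klin0 GL).
- by move=> c x y hx hy; rewrite FL GL hx hy.
- by move=> x hx; rewrite FD GD hx.
- by move=> n x y _ hy; rewrite FH GH hy.
Qed.

(* The projection of [U3 -> V + M], [v |-> (v, p)], where [V + M] is the split
   null extension with zero right action of [V] on [M]. *)
Lemma mod_hom_exists v p : is_U3 D pr v -> (forall n, (3 <= n)%N -> act n v p = 0) ->
  act 1%N v p *+ 2 - 'X * act 2%N v p = p *+ 2 -> exists F, is_mod_hom F /\ F v = p.
Proof.
case: hM => -[actLl actL] actN actD actX actA [[DL [prLl prL] prN [prDl prDr] prA]].
move=> [v3 v2] gen univ p3 p2.
pose W : lmodType k := (V * {poly k})%type.
pose DW (x : W) : W := (D x.1, 'X * x.2).
pose prW n (x y : W) : W := (pr n x.1 y.1, act n x.1 y.2).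
have pairMn (x : W) n : x *+ n = (x.1 *+ n, x.2 *+ n).
  by elim: n => [|n IH] //; rewrite !mulrS IH.
have WA : is_assoc_conf_alg DW prW.
  split.
  - by move=> c x y; congr (_, _); rewrite /= ?DL // mulrDr scalerAr.
  - split=> [n b c x y|n a c x y]; congr (_, _) => /=; rewrite ?prLl ?actLl ?prL ?actL //.
  - move=> [a m] [b m']; case: (prN a b) (actN a m') => N hN [M hM'].
    exists (maxn N M) => n; rewrite geq_max => /andP[/hN h1 /hM' h2].
    by rewrite /prW /= h1 h2.
  - split=> n [a m] [b m']; rewrite pairMn /prW /DW /=; congr (_, _);
      by rewrite /= ?prDl ?prDr ?actD ?actX.
  - move=> n m a b c; rewrite /prW prA actA.
    apply/esym; rewrite [LHS]surjective_pairing; congr (_, _).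
      rewrite (big_morph (fun x : W => x.1) (id1 := 0) (op1 := +%R)) //.
      by apply: eq_bigr => s _; rewrite pairMn.
    rewrite (big_morph (fun x : W => x.2) (id1 := 0) (op1 := +%R)) //.
    by apply: eq_bigr => s _; rewrite pairMn.
have [|f [[fL fD fH] fv]] := univ W DW prW (v, p) WA.
  split=> [n hn|]; first by rewrite /prW /= v3 ?p3.
  by rewrite !pairMn /prW /DW /=; congr (_, _).
(* The first component fixes [v] and respects all operations, so it is the identity and the second
   component is linear for the original action. *)
have f1 x : (f x).1 = x.
  move: x; apply: gen; first by rewrite fv.
  - by rewrite (klin0 fL).
  - by move=> c x y hx hy; rewrite fL /= hx hy.
  - by move=> x hx; rewrite fD /= hx.
  - by move=> n x y hx hy; rewrite fH /= hx hy.
exists (fun x => (f x).2); split; last by rewrite fv.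
split=> [c x y|a|n a b]; first by rewrite fL.
- by rewrite fD.
- by rewrite fH /= f1.
Qed.

End Cochains.

(** * Explicit computations in the rank-one module *)

Section VirasoroModule.
Variables (k : fieldType) (V : lmodType k) (D : V -> V) (pr : nat -> V -> V -> V).
Variables (v : V) (alpha Delta : k) (act : nat -> V -> {poly k} -> {poly k}).
Hypothesis hM : is_M_alpha_Delta D pr v act alpha Delta.

(* The coefficients of [v_lambda p(partial) u = p(partial + lambda) (v_lambda u)]. *)
Lemma act_v n p : act n v p = p^`(n) * (alpha%:P + 'X) + (Delta *: p^`(n.-1)) *+ n.
Proof.
case: hM => -[[_ actL] _ _ actX _] a0 a1 a2.
elim/poly_ind: p n => [|p c IH] n.
  by rewrite (klin0 (actL _ _)) !linear0 mul0r mul0rn addr0.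
have -> : p * 'X + c%:P = 'X * p + c *: 1 by rewrite mulrC -alg_polyC.
rewrite (klinD (actL _ _)) actX (klinZ (actL _ _)) !IH.
rewrite -[c *: 1]/(c%:A) alg_polyC ['X * p]mulrC.
case: n => [|[|[|n]]].
- by rewrite a0 !derivn0 !mulr0n -!mul_polyC; ring.
- by rewrite a1 -!pred_Sn derivnMXaddC !derivn0 -!mul_polyC; ring.
- by rewrite a2 // -!pred_Sn !derivnMXaddC !derivn0 -!mul_polyC; ring.
- by rewrite a2 // -!pred_Sn !derivnMXaddC -!mul_polyC; ring.
Qed.

(** For affine [p] the terms in [partial] cancel, so the defining relations of [U(3)] leave one
    scalar condition. *)
Lemma act_v_linear a b (p := a%:P + b *: 'X) :
  (forall n, (3 <= n)%N -> act n v p = 0) /\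
  act 1%N v p *+ 2 - 'X * act 2%N v p - p *+ 2
  = (b * alpha + (Delta - 1) * a)%:P *+ 2.
Proof.
have p1 : p^`(1) = b%:P by rewrite derivn1 derivD derivC derivZ derivX add0r alg_polyC.
have p2 n : p^`(n.+2) = 0.
  by elim: n => [|n IH]; rewrite derivnS ?p1 ?derivC // IH linear0.
split=> [[|[|[|n]]] // _|].
  by rewrite act_v -pred_Sn !p2 scaler0 mul0r mul0rn addr0.
rewrite !act_v -!pred_Sn p2 p1 derivn0 /p -!mul_polyC.
by rewrite polyCD !polyCM polyCB; ring.
Qed.

Lemma hom_generator_image F : [pchar k] =i pred0 -> Delta != 0 ->
  u3_rel D pr v -> is_mod_hom D pr act F ->
  exists a b, F v = a%:P + b *: 'X /\ b * alpha + (Delta - 1) * a = 0.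
Proof.
move=> hchar hD [v3 v2] [FL FD FH].
have p3 n : (3 <= n)%N -> act n v (F v) = 0.
  by move=> hn; rewrite -FH v3 // (klin0 FL).
have p2 : act 1%N v (F v) *+ 2 - 'X * act 2%N v (F v) = F v *+ 2.
  by rewrite -!FH -FD -!(klinMn FL) -(klinN FL) -(klinD FL) v2.
(* If the size [n] of [F v] is at least 3, then [v_(n) (F v)] is [Delta n!] times the leading
   coefficient, which is nonzero. *)
have sz : (size (F v) <= 2)%N.
  rewrite leqNgt; apply/negP => hs.
  have := p3 _ hs; rewrite act_v derivn_poly0 // mul0r add0r.
  have lc : lead_coef (F v) != 0 by rewrite lead_coef_eq0 -size_poly_gt0; exact: leq_trans hs.
  move: lc; rewrite lead_coefE.
  case: (size (F v)) hs => [//|n] _ /= lc /(polyMn_eq0 hchar)/eqP.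
  rewrite scaler_eq0 (negPf hD) /= => /eqP/(congr1 (fun q : {poly k} => q`_0)).
  rewrite coef_derivn addn0 coef0 ffactnn -mulr_natr => /eqP.
  by rewrite mulf_eq0 (negPf lc) ((pcharf0P k).1 hchar) eqn0Ngt fact_gt0.
exists (F v)`_0, (F v)`_1.
have ev : F v = ((F v)`_0)%:P + (F v)`_1 *: 'X.
  apply/polyP => i; rewrite coefD coefC coefZ coefX.
  case: i => [|[|i]] /=; rewrite ?mulr0 ?mulr1 ?addr0 ?add0r //.
  by rewrite nth_default // (leq_trans sz).
split=> //; have [_] := act_v_linear (F v)`_0 (F v)`_1.
rewrite -ev p2 subrr => /esym/(polyMn_eq0 hchar)/eqP.
by rewrite polyC_eq0 => /eqP.
Qed.

Lemma d0_image F e c : [pchar k] =i pred0 ->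
  is_reduction (d0 act c%:P) F e ->
  F v = (c * alpha)%:P + (c * (1 - Delta)) *: 'X.
Proof.
move=> hchar he.
(* From [alpha + partial + Delta lambda = alpha + (1 - Delta) partial + Delta (partial +
   lambda)]. *)
apply: (reduction_uniq hchar he (w := fun j => (c * Delta)%:P *+ (j == 0)%N)).
  by exists 1%N => -[|j].
move=> j; rewrite /d0 act_v /del -!mul_polyC !polyCM polyCB polyC1.
case: j => [|[|j]].
- by rewrite derivn0 /=; ring.
- by rewrite -pred_Sn derivn0 derivn1 derivC /=; ring.
- by rewrite -pred_Sn derivnC derivnC /=; ring.
Qed.

(* Here [v_lambda m = (partial + lambda) m(partial + lambda)] lies in [partial C~^1]. *)
Lemma d0_image_degenerate F e m : [pchar k] =i pred0 -> Delta = 1 -> alpha = 0 ->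
  is_reduction (d0 act m) F e -> F v = 0.
Proof.
move=> hchar D1 a0 he.
apply: (reduction_uniq hchar he (w := fun j => m^`(j))).
  by exists (size m) => j hj; rewrite derivn_poly0.
by move=> j; rewrite /d0 act_v D1 a0 scale1r mul0rn add0r /del mulrC add0r.
Qed.

End VirasoroModule.

(** * The dimension in the two cases *)

Theorem theorem4p2 (k : fieldType) (hchar : [pchar k] =i pred0)
    (V : lmodType k) (D : V -> V) (pr : nat -> V -> V -> V) (v : V)
    (hU : is_U3 D pr v)
    (alpha Delta : k) (act : nat -> V -> {poly k} -> {poly k})
    (hM : is_M_alpha_Delta D pr v act alpha Delta)
    (hDelta : Delta != 0) :
  H1_dim D pr act (if (Delta == 1) && (alpha == 0) then 2%N else 0%N).
Proof.
have [hA hR gen _] := hU; have [hMod _ _ _] := hM.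
have [[_ actN] _ _ _ _] := hMod.
case: ifP => [/andP[/eqP D1 /eqP a0]|hne]; last first.
  exists (fun _ _ _ => 0); split; [by case| by move=> c _ [] |].
  move=> psi hpsi; exists (fun=> 0).
  have [F [e he]] := reduction_exists hchar hpsi.1.
  have hF := hom_of_cocycle hchar hA hMod hpsi he.
  have [a [b [Fv hab]]] := hom_generator_image hM hchar hDelta hR hF.
  (* The vector [(alpha, 1 - Delta)] is nonzero and spans the line containing [(a, b)]; divide by
     whichever coordinate is nonzero. *)
  have [c [ca cb]] : exists c, c * alpha = a /\ c * (1 - Delta) = b.
    have [al0|al0] := eqVneq alpha 0.
      have D1 : 1 - Delta != 0.
        by apply: contraFN hne; rewrite subr_eq0 al0 eqxx andbT eq_sym.
      exists (b / (1 - Delta)); rewrite divfK //; split=> //.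
      move: hab; rewrite al0 !mulr0 add0r => /eqP.
      by rewrite -opprB mulNr oppr_eq0 mulf_eq0 (negPf D1) => /eqP ->.
    exists (a / alpha); rewrite divfK //; split=> //.
    apply: (mulIf al0); rewrite mulrAC divfK //.
    by apply: (eq_of_subr_eq (esym hab)); ring.
  have hd := d0_cocycle hMod c%:P.
  have [G [e' he']] := reduction_exists hchar hd.1.
  have hG := hom_of_cocycle hchar hA hMod hd he'.
  have FG : F =1 G.
    apply: (mod_hom_eq gen hF hG).
    by rewrite (d0_image hM hchar he') ca cb.
  have [chi [hchi echi]] := cohomologous hchar hpsi.1 he hd.1 he' FG.
  by exists c%:P, chi; split=> // j a'; rewrite big_ord0 subr0.
(* With [Delta = 1] and [alpha = 0] the scalar condition is void, so both [1] and [partial] are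
   images of [v]. *)
have /functional_choice[F hF] : forall i : 'I_2, exists F, is_mod_hom D pr act F /\ F v = 'X^i.
  move=> i.
  have [a [b ->]] : exists a b : k, 'X^i = a%:P + b *: 'X.
    case: i => [[|[|m]] h] //=; first by exists 1, 0; rewrite scale0r addr0.
    by exists 0, 1; rewrite scale1r add0r.
  have [p3 p2] := act_v_linear hM a b.
  apply: (mod_hom_exists hMod hU p3); apply/eqP; rewrite -subr_eq0 p2.
  by rewrite D1 a0 subrr mulr0 mul0r addr0 mul0rn.
have /functional_choice[phi /functional_choice[e hphi]] : forall i : 'I_2,
    exists phi e, is_C1 D phi /\ is_reduction phi (F i) e.
  by move=> i; have [[FL FD _] _] := hF i; apply: lift_of_hom.
have Fv c : \sum_i c i *: F i v = \poly_(i < 2) c (inord i).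
  rewrite poly_def; apply: eq_bigr => i _.
  by rewrite (hF i).2 inord_val.
exists phi; split=> [i|c [m [chi [hchi hc]]] i|psi hpsi].
- exact: (cocycle_of_hom hchar hA hMod (hphi i).1 (hphi i).2 (hF i).1).
- have hs := reduction_sum c (fun i => (hphi i).2).
  have hd := d0_cocycle hMod m.
  have [G [e' he']] := reduction_exists hchar hd.1.
  (* Every coboundary reduces to 0 at [v] here, and the [c i] are the coefficients of this
     polynomial. *)
  have : \sum_i c i *: F i v = 0.
    apply: (reduction_uniq hchar hs (w := fun j => 1 *: e' j v + chi j v)).
      by apply: fin_suppD; [exact: he'.1|case: hchi => _ /(_ v)].
    move=> j; rewrite hc he'.2 (d0_image_degenerate hM hchar D1 a0 he').
    by rewrite delL scale1r !mul0rn !add0r.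
  rewrite Fv => /polyP/(_ i); rewrite coef_poly ltn_ord coef0 => <-.
  by rewrite inord_val.
- have [G [e' he']] := reduction_exists hchar hpsi.1.
  have hG := hom_of_cocycle hchar hA hMod hpsi he'.
  have [a [b [Gv _]]] := hom_generator_image hM hchar hDelta hR hG.
  pose c (i : 'I_2) := if i == ord0 then a else b; exists c.
  have GF : G =1 (fun x => \sum_i c i *: F i x).
    apply: (mod_hom_eq gen hG); first by apply: (mod_hom_sum hMod) => i; case: (hF i).
    by rewrite Gv big_ord_recl big_ord1 /= !(hF _).2 /c /= expr0 alg_polyC.
  have [chi [hchi echi]] := cohomologous hchar hpsi.1 he'
    (C1_sum c (fun i => (hphi i).1)) (reduction_sum c (fun i => (hphi i).2)) GF.
  exists 0, chi; split=> // j x; rewrite echi /d0 (klin0 (actN j x)); ring.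
Qed.
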